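(* Let $c$ be a closed, unit-speed curve of length $2\pi$ in $\mathbf{R}^n$ ($n\ge2$). Then for any $s\in(0,2\pi)$, $$\frac{1}{2\pi}\int |c(t+s)-c(t)|\,dt\;\le\;\lambda(s),$$ where $\lambda(s)=2\sin\frac s2$, with equality if and only if $c$ is the unit circle.
   Context: A closed unit-speed curve of length $2\pi$ in $\mathbf{R}^n$ is an absolutely continuous map $c\colon S^1=\mathbf{R}/2\pi\mathbf{Z}\to\mathbf{R}^n$ with $|c'(t)|=1$ for almost every $t$. The integral is over $S^1$ (one period). ''The unit circle'' means a round circle of radius $1$ in some plane of $\mathbf{R}^n$, traversed once at unit speed. *)

(* Defs.v *)
From HB Require Import structures.
From mathcomp Require Import all_boot all_order all_algebra.
From mathcomp Require Import all_classical all_reals all_analysis.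

Set Implicit Arguments.
Unset Strict Implicit.
Unset Printing Implicit Defensive.

Import Order.TTheory GRing.Theory Num.Theory.
Import numFieldNormedType.Exports.
Local Open Scope classical_set_scope.
Local Open Scope ring_scope.

Definition dotv (R : realType) (n : nat) (u v : 'rV[R]_n) : R :=
  \sum_(i < n) u 0 i * v 0 i.

(* The library norm [`|v|] on ['rV[R]_n] is the sup norm, not this one.
   It induces the same topology, so the derivatives below are unaffected. *)
Definition enorm (R : realType) (n : nat) (v : 'rV[R]_n) : R :=
  Num.sqrt (dotv v v).

Definition abs_continuous (R : realType) (n : nat) (a b : R)
    (f : R -> 'rV[R]_n) : Prop :=
  forall e : R, 0 < e -> exists2 d : R, 0 < d &
    forall (m : nat) (l r : 'I_m -> R),
      (forall i, a <= l i /\ l i <= r i /\ r i <= b) ->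
      trivIset setT (fun i => `]l i, r i[%classic) ->
      \sum_(i < m) (r i - l i) < d ->
      \sum_(i < m) enorm (f (r i) - f (l i)) < e.

(* A map on R/2piZ is a 2pi-periodic map on R; for such a map, absolute
   continuity on the circle amounts to absolute continuity on one period. *)
Definition closed_unit_speed_curve (R : realType) (n : nat)
    (c : R -> 'rV[R]_n) : Prop :=
  [/\ periodic c (2 * pi),
      abs_continuous 0 (2 * pi) c
    & {ae @lebesgue_measure R, forall t : R,
        derivable c t 1 /\ enorm ('D_1 c t) = 1}].

(* [p] is the centre and [u], [v] an orthonormal basis of the plane; the
   choice of basis absorbs the starting point and the orientation. *)
Definition is_unit_circle (R : realType) (n : nat)
    (c : R -> 'rV[R]_n) : Prop :=
  exists p u v : 'rV[R]_n,
    [/\ enorm u = 1, enorm v = 1, dotv u v = 0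
      & forall t : R, c t = p + cos t *: u + sin t *: v].

Definition lambda (R : realType) (s : R) : R := 2 * sin (s / 2).

(* [Rintegral] is 0 on non-integrable functions; here the integrand is
   continuous on a compact interval. *)
Definition mean_chord (R : realType) (n : nat) (c : R -> 'rV[R]_n)
    (s : R) : R :=
  (2 * pi)^-1 *
  \int[@lebesgue_measure R]_(t in `[0, 2 * pi]%classic) enorm (c (t + s) - c t).

(* Main.v *)
(* Write [B k] for the squared norm of the k-th pair of Fourier coefficients of
   [c], summed over coordinates. The mean square chord is
   [Phi s = \sum_k 2 B k * 4 sin (k s / 2) ^ 2]. Unit speed gives [Phi e <= e ^ 2];
   dividing by [e ^ 2] and letting [e] tend to 0 in Bessel's inequality yields the
   energy bound [\sum_k 2 B k * k ^ 2 <= 1]. Since [|sin (k x)| <= k |sin x|],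
   strictly for [k >= 2] and [sin x != 0], one gets [Phi s <= 4 sin (s / 2) ^ 2],
   and equality leaves only the frequencies 0 and 1. Jensen's inequality passes
   from the mean square chord to the mean chord. In the case of equality [c]
   is an ellipse [p + cos t u + sin t v] of speed at most 1 and mean square speed
   1, that is, a unit circle. *)
Require Import Defs.
From HB Require Import structures.
From mathcomp Require Import all_boot all_order all_algebra.
From mathcomp Require Import all_classical all_reals all_analysis.
From mathcomp Require Import measurable_realfun ring lra.

Import Order.TTheory GRing.Theory Num.Theory.
Import numFieldNormedType.Exports.
Local Open Scope classical_set_scope.
Local Open Scope ring_scope.

Set Implicit Arguments.
Unset Strict Implicit.
Unset Printing Implicit Defensive.

(** * Mean value over a period *)

(** Bessel's inequality only bounds [Phi s] from below, and the theorem needs an upper bound. This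
    is the other half of Parseval, in quantitative form: the Fejér means of a Lipschitz function
    approximate it uniformly with squared error [O(1 / N)], and the partial Fourier sum is at least
    as close in mean square. Limits thereby become inequalities with an error [C / N]. The same
    estimate turns the vanishing of the high frequencies into a pointwise formula for [c]. The curve
    enters only through its periodicity and [|c x - c y| <= |x - y|], so all integrands are
    continuous. That Lipschitz bound must be drawn from a derivative known almost everywhere and
    from absolute continuity; a gauge argument compares increments of [c] directly with lengths. *)

Definition mean (R : realType) (f : R -> R) : R :=
  (2 * pi)^-1 * \int[@lebesgue_measure R]_(t in `[0, 2 * pi]%classic) f t.

Section Mean.
Context {R : realType}.
Implicit Types f g : R -> R.

Lemma twopi_gt0 : 0 < 2 * pi :> R.
Proof. by rewrite mulr_gt0 ?pi_gt0. Qed.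

Lemma continuous_integrable f (a b : R) : continuous f ->
  (@lebesgue_measure R).-integrable `[a, b]%classic (EFin \o f).
Proof.
move=> cf; apply: continuous_compact_integrable; first exact: segment_compact.
exact: continuous_subspaceT.
Qed.

Lemma eq_mean f g : f =1 g -> mean f = mean g.
Proof. by move=> fg; congr mean; apply/funext. Qed.

Lemma meanD f g : continuous f -> continuous g ->
  mean (fun t => f t + g t) = mean f + mean g.
Proof.
move=> cf cg; rewrite /mean RintegralD ?mulrDr//.
  exact: continuous_integrable.
exact: continuous_integrable.
Qed.

Lemma meanZ (k : R) f : continuous f -> mean (fun t => k * f t) = k * mean f.
Proof.
move=> cf; rewrite /mean RintegralZl 1?mulrCA//.
exact: continuous_integrable.
Qed.

Lemma mean_cst (k : R) : mean (fun=> k) = k.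
Proof.
rewrite /mean Rintegral_cst//.
rewrite [X in fine X](lebesgue_measure_itv `[0, 2 * pi]) /= lte_fin twopi_gt0.
by rewrite sube0 /= mulrCA mulVf ?mulr1//; exact: lt0r_neq0 twopi_gt0.
Qed.

Lemma mean_le f g : continuous f -> continuous g ->
  (forall t, 0 <= t <= 2 * pi -> f t <= g t) -> mean f <= mean g.
Proof.
move=> cf cg fg; rewrite /mean ler_pM2l ?invr_gt0 ?twopi_gt0//.
by apply: le_Rintegral => //; exact: continuous_integrable.
Qed.

Lemma meanN f : continuous f -> mean (fun t => - f t) = - mean f.
Proof.
move=> cf; rewrite -mulN1r -meanZ//.
by apply: eq_mean => t; rewrite mulN1r.
Qed.

Lemma meanB f g : continuous f -> continuous g ->
  mean (fun t => f t - g t) = mean f - mean g.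
Proof.
move=> cf cg; rewrite meanD ?meanN// => t.
by apply: continuousN; exact: cg.
Qed.

Lemma mean_ge0 f : continuous f -> (forall t, 0 <= f t) -> 0 <= mean f.
Proof.
move=> cf f0; rewrite -(mean_cst 0); apply: mean_le => //.
by move=> t; exact: cst_continuous.
Qed.

Lemma continuous_bigsum (T : topologicalType) (J : Type) (r : seq J)
    (F : J -> T -> R) :
  (forall j, continuous (F j)) -> continuous (fun t => \sum_(j <- r) F j t).
Proof.
move=> cF t; elim: r => [|j r IHr].
  under [X in continuous_at _ X]eq_fun do rewrite big_nil.
  exact: cst_continuous.
under [X in continuous_at _ X]eq_fun do rewrite big_cons.
by apply: continuousD => //; exact: cF.
Qed.

Lemma mean_sum (J : Type) (r : seq J) (F : J -> R -> R) :
  (forall j, continuous (F j)) ->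
  mean (fun t => \sum_(j <- r) F j t) = \sum_(j <- r) mean (F j).
Proof.
move=> cF; elim: r => [|j r IHr].
  by under eq_mean do rewrite big_nil; rewrite mean_cst big_nil.
under eq_mean do rewrite big_cons; rewrite big_cons.
rewrite meanD ?IHr//.
exact: continuous_bigsum.
Qed.

Lemma continuous_primitive f (a b : R) : continuous f ->
  exists F : R -> R, forall x, a < x < b -> is_derive x 1 F (f x).
Proof.
move=> cf.
pose F x : R := \int[@lebesgue_measure R]_(t in `[a, x]%classic) f t.
exists F => x /andP[ax xb].
have [dF eF] : derivable F x 1 /\ derive1 F x = f x.
  exact: continuous_FTC1_closed xb (continuous_integrable a b cf) ax (cf x).
by rewrite -eF derive1E; exact: derivableP.
Qed.

(** The margin of 1 makes [F] differentiable, hence continuous, at both end points of the period. *)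
Lemma mean_primitive f F (s : R) : continuous f ->
  (forall x, s - 1 < x < s + 2 * pi + 1 -> is_derive x 1 F (f x)) ->
  mean (fun t => f (t + s)) = (2 * pi)^-1 * (F (s + 2 * pi) - F s).
Proof.
move=> cf dF; rewrite /mean /Rintegral.
have p0 := twopi_gt0.
have dFs x : -1 < x < 2 * pi + 1 -> is_derive x 1 (fun t => F (t + s)) (f (x + s)).
  move=> /andP[x1 x2].
  rewrite -[X in is_derive _ _ _ X]mulr1.
  have -> : (fun t => F (t + s)) = F \o (fun t => t + s) by [].
  apply: is_derive1_comp; first by apply: dF; lra.
  by rewrite -[X in is_derive _ _ _ X]addr0; apply: is_deriveD.
have cFs x : -1 < x < 2 * pi + 1 -> {for x, continuous (fun t => F (t + s))}.
  move=> /dFs [dx _].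
  by apply/differentiable_continuous; rewrite -derivable1_diffP.
rewrite (@continuous_FTC2 _ (fun t => f (t + s)) (fun t => F (t + s)))//.
- by rewrite -EFinB /= add0r [2 * pi + s]addrC.
- apply: continuous_subspaceT => x; apply: continuous_comp; last exact: cf.
  by apply: continuousD => //; exact: cst_continuous.
- split.
  + move=> x; rewrite in_itv /= => xI.
    by have [] := dFs x ltac:(lra).
  + by apply: cvg_at_right_filter; apply: cFs; lra.
  + by apply: cvg_at_left_filter; apply: cFs; lra.
- move=> x; rewrite in_itv /= => xI; rewrite derive1E.
  by have [_] := dFs x ltac:(lra).
Qed.

(** For a primitive [F] of [f], the map [F (t + 2 * pi) - F t] has derivative zero by periodicity;
    up to the factor [(2 * pi)^-1], the two means are its values at [s] and at 0. *)
Lemma mean_shift f (s : R) : continuous f -> periodic f (2 * pi) ->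
  mean (fun t => f (t + s)) = mean f.
Proof.
move=> cf pf.
have p0 := twopi_gt0.
have s0 := normr_ge0 s; have := ler_norm s; have := ler_norm (- s).
(* Both periods, the one from 0 and the one from [s], fit in []a, b[] with the margin of 1 that
   [mean_primitive] asks for. *)
rewrite normrN; set a := - `|s| - 2; set b := `|s| + 2 * pi + 2 => sN sP.
have [F dF] := @continuous_primitive f a b cf.
have dH x : a < x < b - 2 * pi ->
    is_derive x 1 (fun t => F (t + 2 * pi) - F t) 0.
  move=> x_ab.
  rewrite -(subrr (f x)) -[X in is_derive _ _ _ (X - _)]pf.
  apply: is_deriveB; last by apply: dF; lra.
  rewrite -[X in is_derive _ _ _ X]mulr1.
  have -> : (fun t => F (t + 2 * pi)) = F \o (fun t => t + 2 * pi) by [].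
  apply: is_derive1_comp; first by apply: dF; lra.
  by rewrite -[X in is_derive _ _ _ X]addr0; apply: is_deriveD.
have Hcst x y : a < x -> x <= y -> y < b - 2 * pi ->
    F (x + 2 * pi) - F x = F (y + 2 * pi) - F y.
  move=> ax xy yb.
  have [|||z _] := @MVT_segment _ (fun t => F (t + 2 * pi) - F t) (fun=> 0) x y.
  - by [].
  - by move=> z; rewrite in_itv /= => zI; apply: dH; lra.
  - apply: derivable_within_continuous => z; rewrite in_itv /= => zI.
    by have [] := dH z ltac:(lra).
  by rewrite mul0r => /eqP; rewrite subr_eq0 => /eqP.
have dF' r : r = s \/ r = 0 ->
    forall x, r - 1 < x < r + 2 * pi + 1 -> is_derive x 1 F (f x).
  by move=> rE x xI; apply: dF; case: rE xI => ->; rewrite /a /b; lra.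
rewrite (mean_primitive cf (dF' s (or_introl erefl))).
have -> : mean f = mean (fun t => f (t + 0)) by apply: eq_mean => t; rewrite addr0.
rewrite (mean_primitive cf (dF' 0 (or_intror erefl))).
congr (_ * _); have [s_le0|s_gt0] := leP s 0.
  by apply: Hcst => //; rewrite /a /b; lra.
by symmetry; apply: Hcst => //; [| exact: ltW |]; rewrite /a /b; lra.
Qed.

End Mean.

(** * Orthogonality of the trigonometric system *)

Section ContinuousReal.
Context {R : realType}.
Implicit Types f g : R -> R.

Lemma continuous_cst (k : R) : continuous (fun _ : R => k).
Proof. by move=> t; exact: cst_continuous. Qed.

Lemma continuous_addf f g : continuous f -> continuous g ->
  continuous (fun t => f t + g t).
Proof. by move=> cf cg t; apply: continuousD; [exact: cf|exact: cg]. Qed.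

Lemma continuous_oppf f : continuous f -> continuous (fun t => - f t).
Proof. by move=> cf t; apply: continuousN; exact: cf. Qed.

Lemma continuous_mulf f g : continuous f -> continuous g ->
  continuous (fun t => f t * g t).
Proof. by move=> cf cg t; apply: continuousM; [exact: cf|exact: cg]. Qed.

Lemma continuous_sqrf f : continuous f -> continuous (fun t => f t ^+ 2).
Proof. by move=> cf; exact: continuous_mulf. Qed.

Lemma continuous_cosf f : continuous f -> continuous (fun t => cos (f t)).
Proof.
by move=> cf t; apply: continuous_comp; [exact: cf|exact: continuous_cos].
Qed.

Lemma continuous_sinf f : continuous f -> continuous (fun t => sin (f t)).
Proof.
by move=> cf t; apply: continuous_comp; [exact: cf|exact: continuous_sin].
Qed.

Lemma continuous_idf : continuous (fun t : R => t).
Proof. by move=> t; exact: cvg_id. Qed.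

Lemma continuous_shiftf f (s : R) : continuous f -> continuous (fun t => f (t + s)).
Proof.
move=> cf t; apply: (@continuous_comp _ _ _ (fun t => t + s) f).
  by apply: continuousD; [exact: cvg_id|exact: cst_continuous].
exact: cf.
Qed.

End ContinuousReal.

Ltac cts := lazymatch goal with
  | |- continuous (fun t => @?f t + @?g t) =>
      apply: (@continuous_addf _ f g); cts
  | |- continuous (fun t => @?f t * @?g t) =>
      apply: (@continuous_mulf _ f g); cts
  | |- continuous (fun t => - @?f t) => apply: (@continuous_oppf _ f); cts
  | |- continuous (fun t => @?f t ^+ 2) => apply: (@continuous_sqrf _ f); cts
  | |- continuous (fun t => cos (@?f t)) => apply: (@continuous_cosf _ f); cts
  | |- continuous (fun t => sin (@?f t)) => apply: (@continuous_sinf _ f); cts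
  | |- continuous (fun t => \sum_(i <- _) (@?F t i)) =>
      refine (@continuous_bigsum _ _ _ _ _ _); let i := fresh in intro i; cts
  | |- continuous (fun t => t) => exact: continuous_idf
  | |- continuous (fun t => ?f (t + ?s)) => apply: (@continuous_shiftf _ f s); cts
  | |- _ => first [assumption | exact: continuous_cst]
  end.

Section Orthogonality.
Context {R : realType}.
Implicit Types (j k n : nat) (t : R).

Lemma cosnD2pi n t : cos (n%:R * (t + 2 * pi)) = cos (n%:R * t).
Proof.
rewrite (_ : n%:R * (t + 2 * pi) = n%:R * t + (pi *+ 2) *+ n).
  by rewrite (periodicn (@cosD2pi R)).
by rewrite mulrDr -[(_ *+ 2) *+ n]mulr_natl mulr_natl -[pi *+ 2]mulr_natl.
Qed.

Lemma sinnD2pi n t : sin (n%:R * (t + 2 * pi)) = sin (n%:R * t).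
Proof.
rewrite (_ : n%:R * (t + 2 * pi) = n%:R * t + (pi *+ 2) *+ n).
  by rewrite (periodicn (@sinD2pi R)).
by rewrite mulrDr -[(_ *+ 2) *+ n]mulr_natl mulr_natl -[pi *+ 2]mulr_natl.
Qed.

(** For positive [n], translation by [pi / n] changes the sign of the integrand and preserves its
    mean. *)
Lemma mean_cosn n : mean (fun t => cos (n%:R * t)) = (n == 0%N)%:R :> R.
Proof.
case: n => [|n].
  by under eq_mean do rewrite mul0r cos0; rewrite mean_cst.
have h : mean (fun t => cos (n.+1%:R * t)) = - mean (fun t => cos (n.+1%:R * t)) :> R.
  rewrite -[LHS](@mean_shift R _ (pi / n.+1%:R)); last 2 first.
  - by cts.
  - by move=> t; exact: cosnD2pi.
  rewrite -meanN; last by cts.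
  apply: eq_mean => t; rewrite mulrDr mulrCA divff ?pnatr_eq0// mulr1.
  exact: cosDpi.
by rewrite /=; lra.
Qed.

Lemma mean_sinn n : mean (fun t => sin (n%:R * t)) = 0 :> R.
Proof.
case: n => [|n].
  by under eq_mean do rewrite mul0r sin0; rewrite mean_cst.
have h : mean (fun t => sin (n.+1%:R * t)) = - mean (fun t => sin (n.+1%:R * t)) :> R.
  rewrite -[LHS](@mean_shift R _ (pi / n.+1%:R)); last 2 first.
  - by cts.
  - by move=> t; exact: sinnD2pi.
  rewrite -meanN; last by cts.
  apply: eq_mean => t; rewrite mulrDr mulrCA divff ?pnatr_eq0// mulr1.
  exact: sinDpi.
by lra.
Qed.

Lemma mean_cosnB j k :
  mean (fun t => cos (j%:R * t - k%:R * t)) = (j == k)%:R :> R.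
Proof.
wlog jk : j k / (j <= k)%N.
  move=> h; case: (leqP j k) => [|/ltnW] jk; first exact: h.
  rewrite eq_sym -h//; apply: eq_mean => t.
  by rewrite -cosN opprB.
rewrite -(subnKC jk) -[X in (X == _)]addn0 eqn_add2l eq_sym -mean_cosn.
apply: eq_mean => t.
by rewrite -cosN natrD mulrDl opprB addrC addKr.
Qed.

Lemma mean_sinnB j k : mean (fun t => sin (j%:R * t - k%:R * t)) = 0 :> R.
Proof.
wlog jk : j k / (k <= j)%N.
  move=> h; case: (leqP k j) => [|/ltnW] jk; first exact: h.
  have cs : continuous (fun t : R => sin (k%:R * t - j%:R * t)) by cts.
  rewrite -[RHS]oppr0 -(h k j)// -meanN//; apply: eq_mean => t.
  by rewrite -sinN opprB.
rewrite -(mean_sinn (j - k)); apply: eq_mean => t.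
by rewrite -mulrBl natrB.
Qed.

(* Fourier weights: the squares of cos (k t) and sin (k t) have mean
   [(fw k)^-1], except that sin (0 t) is zero. *)
Definition fw k : R := if k == 0%N then 1 else 2.

Lemma fw_gt0 k : 0 < fw k.
Proof. by rewrite /fw; case: ifP. Qed.

Lemma mean_coscos j k :
  mean (fun t => cos (j%:R * t) * cos (k%:R * t)) = (j == k)%:R / fw k :> R.
Proof.
rewrite (_ : mean _ = mean (fun t => 2^-1 *
    (cos (j%:R * t - k%:R * t) + cos ((j + k)%N%:R * t)))); last first.
  by apply: eq_mean => t; rewrite natrD mulrDl cosB cosD; lra.
rewrite meanZ; last by cts.
rewrite meanD; [|cts..].
rewrite mean_cosnB mean_cosn addn_eq0 /fw.
case: j k => [|j] [|k] //=; rewrite ?eqSS.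
all: by try case: eqP => _; lra.
Qed.

Lemma mean_sinsin j k : mean (fun t => sin (j%:R * t) * sin (k%:R * t)) =
  ((j == k) && (k != 0%N))%:R / fw k :> R.
Proof.
rewrite (_ : mean _ = mean (fun t => 2^-1 *
    (cos (j%:R * t - k%:R * t) - cos ((j + k)%N%:R * t)))); last first.
  by apply: eq_mean => t; rewrite natrD mulrDl cosB cosD; lra.
rewrite meanZ; last by cts.
rewrite meanB; [|cts..].
rewrite mean_cosnB mean_cosn addn_eq0 /fw.
case: j k => [|j] [|k] //=; rewrite ?eqSS ?andbT.
all: by try case: eqP => _; lra.
Qed.

Lemma mean_sincos j k :
  mean (fun t => sin (j%:R * t) * cos (k%:R * t)) = 0 :> R.
Proof.
rewrite (_ : mean _ = mean (fun t => 2^-1 *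
    (sin (j%:R * t - k%:R * t) + sin ((j + k)%N%:R * t)))); last first.
  by apply: eq_mean => t; rewrite natrD mulrDl sinB sinD; lra.
rewrite meanZ; last by cts.
rewrite meanD; [|cts..].
by rewrite mean_sinnB mean_sinn addr0 mulr0.
Qed.

End Orthogonality.
Arguments fw : clear implicits.

(** * Fourier coefficients *)

Section Fourier.
Context {R : realType}.
Implicit Types (f g : R -> R) (p q : nat -> R) (N k : nat).

(** Being means, [fcos] and [fsin] are half the classical coefficients for [k > 0], which [fw]
    corrects; [fpow] is the squared modulus of the complex coefficient. *)
Definition fcos f k : R := mean (fun t => f t * cos (k%:R * t)).
Definition fsin f k : R := mean (fun t => f t * sin (k%:R * t)).
Definition fpow f k : R := fcos f k ^+ 2 + fsin f k ^+ 2.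

Definition trigpoly N p q (t : R) : R :=
  \sum_(k < N) (p k * cos (k%:R * t) + q k * sin (k%:R * t)).

Lemma continuous_trigpoly N p q : continuous (trigpoly N p q).
Proof. by rewrite /trigpoly; cts. Qed.

Lemma fsin0 f : fsin f 0 = 0.
Proof.
by rewrite /fsin; under eq_mean do rewrite mul0r sin0 mulr0; rewrite mean_cst.
Qed.

Lemma fpow_ge0 f k : 0 <= fpow f k.
Proof. by rewrite addr_ge0 ?sqr_ge0. Qed.

Lemma mean_mul_trigpoly f N p q : continuous f ->
  mean (fun t => f t * trigpoly N p q t) =
  \sum_(k < N) (p k * fcos f k + q k * fsin f k).
Proof.
move=> cf.
rewrite (_ : mean _ = mean (fun t => \sum_(k < N)
    (p k * (f t * cos (k%:R * t)) + q k * (f t * sin (k%:R * t))))); last first.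
  apply: eq_mean => t; rewrite /trigpoly mulr_sumr; apply: eq_bigr => k _; ring.
rewrite mean_sum; last by move=> k; cts.
by apply: eq_bigr => k _; rewrite meanD; [rewrite !meanZ//; cts | cts | cts].
Qed.

Lemma fcos_trigpoly N p q k : (k < N)%N ->
  fcos (trigpoly N p q) k = p k / fw R k.
Proof.
move=> kN.
have -> : fcos (trigpoly N p q) k =
    mean (fun t => cos (k%:R * t) * trigpoly N p q t).
  by apply: eq_mean => t; rewrite mulrC.
rewrite mean_mul_trigpoly; last by cts.
rewrite (bigD1 (Ordinal kN)) //= big1 => [|j].
  rewrite /fcos /fsin mean_coscos eqxx mul1r.
  under [mean _]eq_mean do rewrite mulrC.
  by rewrite mean_sincos mulr0 !addr0.
move=> /eqP jk.
rewrite /fcos /fsin mean_coscos.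
under [X in _ + _ * X]eq_mean do rewrite mulrC.
rewrite mean_sincos mulr0 addr0.
case: eqP => [kj|_]; last by rewrite mul0r mulr0.
by case: jk; apply: val_inj.
Qed.

Lemma fsin_trigpoly N p q k : (0 < k < N)%N ->
  fsin (trigpoly N p q) k = q k / fw R k.
Proof.
move=> /andP[k0 kN].
have -> : fsin (trigpoly N p q) k =
    mean (fun t => sin (k%:R * t) * trigpoly N p q t).
  by apply: eq_mean => t; rewrite mulrC.
rewrite mean_mul_trigpoly; last by cts.
rewrite (bigD1 (Ordinal kN)) //= big1 => [|j].
  by rewrite /fcos /fsin mean_sinsin eqxx -lt0n k0 mul1r mean_sincos mulr0 addr0 add0r.
move=> /eqP jk.
rewrite /fcos /fsin mean_sincos mean_sinsin mulr0 add0r.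
case: eqP => [kj|_]; last by rewrite mul0r mulr0.
by case: jk; apply: val_inj.
Qed.

Definition fsum f N := trigpoly N (fun k => fw R k * fcos f k)
                                  (fun k => fw R k * fsin f k).

Lemma continuous_fsum f N : continuous (fsum f N).
Proof. exact: continuous_trigpoly. Qed.

Lemma fcos_fsum f N k : (k < N)%N -> fcos (fsum f N) k = fcos f k.
Proof.
move=> kN; rewrite fcos_trigpoly// mulrAC mulfV ?mul1r//.
exact: lt0r_neq0 (fw_gt0 k).
Qed.

Lemma fsin_fsum f N k : (k < N)%N -> fsin (fsum f N) k = fsin f k.
Proof.
case: k => [_|k kN]; first by rewrite !fsin0.
rewrite fsin_trigpoly// mulrAC mulfV ?mul1r//.
exact: lt0r_neq0 (fw_gt0 k.+1).
Qed.

Lemma mean_mul_fsum f N : continuous f ->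
  mean (fun t => f t * fsum f N t) = \sum_(k < N) fw R k * fpow f k.
Proof.
move=> cf; rewrite mean_mul_trigpoly//.
by apply: eq_bigr => k _; rewrite /fpow; ring.
Qed.

Lemma trigpoly_orthogonal f N p q : continuous f ->
  mean (fun t => (f t - fsum f N t) * trigpoly N p q t) = 0.
Proof.
move=> cf; have cS := @continuous_fsum f N; have cT := @continuous_trigpoly N p q.
under eq_mean do rewrite mulrBl.
rewrite meanB; [|cts..].
rewrite !mean_mul_trigpoly//; apply/eqP; rewrite subr_eq0; apply/eqP.
by apply: eq_bigr => k _; rewrite fcos_fsum// fsin_fsum.
Qed.

Lemma mean_fsum_dist f N : continuous f ->
  mean (fun t => (f t - fsum f N t) ^+ 2) =
  mean (fun t => f t ^+ 2) - \sum_(k < N) fw R k * fpow f k.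
Proof.
move=> cf; have cS := @continuous_fsum f N.
rewrite (_ : mean _ = mean (fun t => (f t ^+ 2 - f t * fsum f N t) -
    (f t - fsum f N t) * fsum f N t)); last by apply: eq_mean => t; ring.
rewrite meanB; [|cts..].
by rewrite trigpoly_orthogonal// subr0 meanB; [rewrite mean_mul_fsum|cts..].
Qed.

Lemma bessel f N : continuous f ->
  \sum_(k < N) fw R k * fpow f k <= mean (fun t => f t ^+ 2).
Proof.
move=> cf; have cS := @continuous_fsum f N.
rewrite -subr_ge0 -mean_fsum_dist//; apply: mean_ge0; first by cts.
by move=> t; exact: sqr_ge0.
Qed.

(** Pythagoras: [f - fsum f N] is orthogonal to every trigonometric polynomial of this order, so
    replacing [fsum f N] by another one only increases the distance to [f]. *)
Lemma best_approximation f N p q : continuous f ->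
  mean (fun t => f t ^+ 2) <=
  \sum_(k < N) fw R k * fpow f k + mean (fun t => (trigpoly N p q t - f t) ^+ 2).
Proof.
move=> cf; have cS := @continuous_fsum f N; have cT := @continuous_trigpoly N p q.
rewrite -lerBlDl -mean_fsum_dist//.
pose h t := f t - fsum f N t; pose d t := trigpoly N p q t - fsum f N t.
have ch : continuous h by rewrite /h; cts.
have cd : continuous d by rewrite /d; cts.
have hd : mean (fun t => h t * d t) = 0.
  rewrite (_ : mean _ = mean (fun t => h t * trigpoly N p q t - h t * fsum f N t)).
    by rewrite meanB; [rewrite !trigpoly_orthogonal// subr0|cts..].
  by apply: eq_mean => t; rewrite /d; ring.
have -> : mean (fun t => (trigpoly N p q t - f t) ^+ 2) =
    mean (fun t => h t ^+ 2 + (d t ^+ 2 - 2 * (h t * d t))).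
  by apply: eq_mean => t; rewrite /h /d; ring.
rewrite meanD; [|cts..]; rewrite meanB; [|cts..]; rewrite meanZ; last by cts.
rewrite hd mulr0 subr0 lerDl; apply: mean_ge0; first by cts.
by move=> t; exact: sqr_ge0.
Qed.

End Fourier.

(** * Fejér means *)

Section Fejer.
Context {R : realType}.
Implicit Types (f g w : R -> R) (N k : nat).

(** Cesàro weights: [fejer N] is the sum of [(1 - |k| / N) exp (i k t)] over [|k| < N], with [fw]
    merging the frequencies [k] and [-k]. *)
Definition fejer_weight N k : R := fw R k * (1 - k%:R / N%:R).
Definition fejer N : R -> R := trigpoly N (fejer_weight N) (fun=> 0).

(** The right side is the squared modulus of the sum of [exp (i k t)] over [k < N], whence
    positivity of the kernel. With [N] cleared from the denominator, induction applies. *)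
Lemma fejerE N (t : R) : (0 < N)%N -> N%:R * fejer N t =
  (\sum_(k < N) cos (k%:R * t)) ^+ 2 + (\sum_(k < N) sin (k%:R * t)) ^+ 2.
Proof.
move=> N0.
have -> : N%:R * fejer N t = \sum_(k < N) fw R k * (N%:R - k%:R) * cos (k%:R * t).
  rewrite mulr_sumr; apply: eq_bigr => k _.
  have : N%:R != 0 :> R by rewrite pnatr_eq0 -lt0n.
  by rewrite /fejer_weight => ?; field.
elim: N {N0} => [|N IHN]; first by rewrite !big_ord0 expr0n addr0.
have -> : \sum_(k < N.+1) fw R k * (N.+1%:R - k%:R) * cos (k%:R * t) =
    \sum_(k < N) fw R k * (N%:R - k%:R) * cos (k%:R * t) +
    \sum_(k < N.+1) fw R k * cos (k%:R * t).
  rewrite !big_ord_recr /= addrA -big_split /= -natr1; congr (_ + _); last by ring.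
  by apply: eq_bigr => k _; ring.
rewrite IHN ![in RHS]big_ord_recr big_ord_recl /=.
under [X in _ + (_ + X)]eq_bigr do rewrite /bump /= add1n /fw /=.
(* The cross terms between the new exponential of frequency [N] and the older ones are
   [2 cos ((N - k) t)]; reversing the index gives the sum on the left. *)
have -> : \sum_(i < N) 2 * cos (i.+1%:R * t) =
    2 * (cos (N%:R * t) * \sum_(k < N) cos (k%:R * t) +
         sin (N%:R * t) * \sum_(k < N) sin (k%:R * t)).
  rewrite -mulr_sumr; congr (_ * _).
  rewrite !mulr_sumr -big_split /= (reindex_inj rev_ord_inj) /=.
  apply: eq_bigr => k _; rewrite -cosB -mulrBl; congr (cos (_ * _)).
  by rewrite subnSK// natrB// ltnW.
by rewrite /fw /= mul0r cos0 !sqrrD sin2cos2; ring.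
Qed.

Lemma fejer_ge0 N (t : R) : 0 <= fejer N t.
Proof.
case: N => [|N]; first by rewrite /fejer /trigpoly big_ord0.
by rewrite -(@pmulr_rge0 _ N.+1%:R)// fejerE// addr_ge0 ?sqr_ge0.
Qed.

Lemma mean_fejer N : (0 < N)%N -> mean (fejer N) = 1.
Proof.
move=> N0; rewrite -(@eq_mean R (fun t => fejer N t * cos (0%:R * t))); last first.
  by move=> t; rewrite mul0r cos0 mulr1.
by rewrite [LHS]fcos_trigpoly// /fejer_weight /fw/= mul0r subr0 mulr1 divr1.
Qed.

(** Measures how the kernel concentrates at 0. Its coefficient at frequency 1 is [1 - 1 / N]; for
    [N = 1] that frequency lies outside the sum and is treated apart. *)
Lemma mean_fejer_cos N : (0 < N)%N ->
  mean (fun t => fejer N t * (1 - cos t)) = N%:R^-1.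
Proof.
move=> N0; have cF : continuous (fejer N) by exact: continuous_trigpoly.
under eq_mean do rewrite mulrBr mulr1.
rewrite meanB; [|cts..]; rewrite mean_fejer//.
rewrite -(@eq_mean R (fun t => fejer N t * cos (1%:R * t))); last first.
  by move=> t; rewrite mul1r.
case: N N0 {cF} => // -[_|N _].
  rewrite invr1 (_ : fejer 1 = fun=> 1).
    by under eq_mean do rewrite mul1r; rewrite mean_cosn subr0.
  apply/funext => t; rewrite /fejer /trigpoly big_ord1 /fejer_weight /fw /=.
  by rewrite !mul0r cos0 addr0 subr0 !mulr1.
rewrite [X in _ - X]fcos_trigpoly// /fejer_weight /fw /=.
have : N.+2%:R != 0 :> R by rewrite pnatr_eq0.
by move=> ?; field.
Qed.

(** The variance of [g] for the probability density [w] is nonnegative. *)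
Lemma jensen_sqr w g : continuous w -> continuous g -> (forall t, 0 <= w t) ->
  mean w = 1 -> mean (fun t => w t * g t) ^+ 2 <= mean (fun t => w t * g t ^+ 2).
Proof.
move=> cw cg w0 w1; set m := mean (fun t => w t * g t).
have : 0 <= mean (fun t => w t * (g t - m) ^+ 2).
  by apply: mean_ge0 => [|t]; [cts|rewrite mulr_ge0 ?sqr_ge0].
have -> : mean (fun t => w t * (g t - m) ^+ 2) =
    mean (fun t => w t * g t ^+ 2 + (m ^+ 2 * w t - (2 * m) * (w t * g t))).
  by apply: eq_mean => t; ring.
rewrite meanD; [|cts..]; rewrite meanB; [|cts..].
rewrite !meanZ; [|cts..]; rewrite -/m w1 => h.
by rewrite -subr_ge0; apply: le_trans h _; rewrite le_eqVlt; apply/orP; left; apply/eqP; ring.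
Qed.

Lemma sin_ge_mul_cos (v : R) : 0 <= v <= pi / 2 -> v * cos v <= sin v.
Proof.
move=> /andP[v0 v1]; have p2 := pi_gt0 R.
have [|z /[!in_itv] /= /andP[z0 zv]] := @MVT_segment R (@sin R) (@cos R) 0 v v0 _.
  by apply: continuous_subspaceT; exact: continuous_sin.
rewrite sin0 !subr0 => ->; rewrite mulrC ler_wpM2r//.
move: zv; rewrite le_eqVlt => /predU1P[->//|zv].
by apply/ltW; rewrite ltr_cos// in_itv /=; lra.
Qed.

(** With [v = u / 2], [sin u = 2 sin v cos v >= 2 v cos v ^ 2], and [cos v ^ 2 >= 1 / 2] because
    [cos u >= 0]. *)
Lemma sin_ge_half (u : R) : 0 <= u <= pi / 2 -> u / 2 <= sin u.
Proof.
move=> /andP[u0 u1]; have p2 := pi_gt0 R.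
set v := u / 2; have v0 : 0 <= v by rewrite divr_ge0.
have hv : v * cos v <= sin v by apply: sin_ge_mul_cos; rewrite /v; lra.
have cv : 0 <= cos v by apply: cos_ge0_pihalf; rewrite /v; lra.
have c2 : 0 <= cos u by apply: cos_ge0_pihalf; lra.
have uv : u = v *+ 2 by rewrite mulr2n /v -splitr.
move: c2; rewrite uv cos_mulr2n sin_mulr2n => c2.
have h2 : 1 / 2 <= cos v * cos v by move: c2; rewrite expr2 mulr2n; lra.
have h3 : v / 2 <= cos v * (v * cos v).
  by rewrite mulrCA ler_wpM2l// -div1r.
have h4 : cos v * (v * cos v) <= cos v * sin v by rewrite ler_wpM2l.
by rewrite mulr2n; lra.
Qed.

(** The 8 comes from [1 - cos t = 2 sin (t / 2) ^ 2 >= 2 (t / 4) ^ 2]. *)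
Lemma sqr_le_cos (t : R) : 0 <= t <= pi -> t ^+ 2 <= 8 * (1 - cos t).
Proof.
move=> /andP[t0 tp].
have := @sin_ge_half (t / 2) ltac:(lra).
have -> : cos t = 1 - 2 * sin (t / 2) ^+ 2.
  rewrite [in LHS](_ : t = (t / 2) *+ 2); last by rewrite mulr2n -splitr.
  by rewrite cos_mulr2n cos2sin2 mulr2n; ring.
move=> h; have : (t / 2 / 2) ^+ 2 <= sin (t / 2) ^+ 2.
  by rewrite lerXn2r// nnegrE; lra.
lra.
Qed.

(** [L] is the square of the usual constant; the squared form can be summed over coordinates. *)
Definition lipschitz (L : R) f := forall x y, (f x - f y) ^+ 2 <= L * (x - y) ^+ 2.

(** Beyond [pi] the shorter arc goes the other way round: periodicity replaces [t] by
    [2 * pi - t]. *)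
Lemma lipschitz_cos L f (x t : R) : 0 <= L -> periodic f (2 * pi) -> lipschitz L f ->
  0 <= t <= 2 * pi -> (f (t + x) - f x) ^+ 2 <= 8 * L * (1 - cos t).
Proof.
move=> L0 pf lf /andP[t0 tp].
have [tpi|tpi] := leP t pi.
  apply: (le_trans (lf _ _)); rewrite addrK mulrAC mulrC ler_wpM2r//.
  by apply: sqr_le_cos; rewrite t0.
have -> : f x = f (x + 2 * pi) by rewrite pf.
apply: (le_trans (lf _ _)).
have -> : t + x - (x + 2 * pi) = t - 2 * pi by ring.
rewrite -sqrrN opprB mulrAC mulrC ler_wpM2r//.
have -> : cos t = cos (2 * pi - t).
  by rewrite -[RHS]cosN opprB -[RHS](@cosD2pi R) -[pi *+ 2]mulr_natl subrK.
by apply: sqr_le_cos; lra.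
Qed.

Definition fejer_mean f N := trigpoly N (fun k => fejer_weight N k * fcos f k)
                                        (fun k => fejer_weight N k * fsin f k).

Lemma trigpoly_periodic N p q : periodic (@trigpoly R N p q) (2 * pi).
Proof.
by move=> t; apply: eq_bigr => k _; rewrite cosnD2pi sinnD2pi.
Qed.

(** Cesàro means are convolutions with the Fejér kernel: expand [cos (k (t - x))]. *)
Lemma fejer_meanE f N (x : R) : continuous f -> periodic f (2 * pi) ->
  fejer_mean f N x = mean (fun t => fejer N t * f (t + x)).
Proof.
move=> cf pf; have cF : continuous (fejer N) by exact: continuous_trigpoly.
transitivity (mean (fun t => fejer N (t - x) * f t)); last first.
  rewrite -[LHS](@mean_shift R _ x); [|cts|].
    by apply: eq_mean => t; rewrite addrK.
  by move=> t; rewrite pf -addrA [2 * pi - x]addrC addrA [fejer _ _]trigpoly_periodic.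
rewrite (_ : mean _ = mean (fun t => f t * trigpoly N
    (fun k => fejer_weight N k * cos (k%:R * x))
    (fun k => fejer_weight N k * sin (k%:R * x)) t)); last first.
  apply: eq_mean => t; rewrite mulrC; congr (_ * _).
  apply: eq_bigr => k _; rewrite mulrBr cosB; ring.
rewrite mean_mul_trigpoly//; apply: eq_bigr => k _; ring.
Qed.

(** The error is the average of [f (t + x) - f x] for the density [fejer N]. Jensen moves the square
    inside, where it is at most [8 L (1 - cos t)], of average [8 L / N]. *)
Lemma fejer_approximation L f N (x : R) : (0 < N)%N -> continuous f ->
  periodic f (2 * pi) -> 0 <= L -> lipschitz L f ->
  (fejer_mean f N x - f x) ^+ 2 <= 8 * L / N%:R.
Proof.
move=> N0 cf pf L0 lf.
have cF : continuous (fejer N) by exact: continuous_trigpoly.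
rewrite fejer_meanE// (_ : _ - _ = mean (fun t => fejer N t * (f (t + x) - f x))).
  have cg : continuous (fun t => f (t + x) - f x) by cts.
  apply: le_trans (jensen_sqr cF cg _ _) _.
  - exact: fejer_ge0.
  - exact: mean_fejer.
  rewrite -mean_fejer_cos// -meanZ; last by cts.
  apply: mean_le; [cts..|] => t t2; rewrite [leRHS]mulrCA ler_wpM2l ?fejer_ge0//.
  exact: lipschitz_cos.
under [in RHS]eq_mean do rewrite mulrBr [_ * f x]mulrC.
by rewrite meanB; [rewrite meanZ ?mean_fejer ?mulr1|cts..].
Qed.

Lemma parseval_upper L f N : (0 < N)%N -> continuous f -> periodic f (2 * pi) ->
  0 <= L -> lipschitz L f ->
  mean (fun t => f t ^+ 2) <= \sum_(k < N) fw R k * fpow f k + 8 * L / N%:R.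
Proof.
move=> N0 cf pf L0 lf.
have h := best_approximation N (fun k => fejer_weight N k * fcos f k)
  (fun k => fejer_weight N k * fsin f k) cf.
apply: (le_trans h).
rewrite lerD2l -[leRHS]mean_cst; apply: mean_le => [||t _].
- have cT : continuous (fejer_mean f N) by exact: continuous_trigpoly.
  have cd : continuous (fun t => fejer_mean f N t - f t) by cts.
  exact: continuous_sqrf cd.
- exact: continuous_cst.
- exact: fejer_approximation.
Qed.

End Fejer.

(** * Trigonometric inequalities *)

Section Trig.
Context {R : realType}.
Implicit Types (x v : R) (k N : nat).

Lemma sin_le x : 0 <= x -> sin x <= x.
Proof.
move=> x0.
have [|z _] := @MVT_segment R (@sin R) (@cos R) 0 x x0 _.
  by apply: continuous_subspaceT; exact: continuous_sin.
by rewrite sin0 !subr0 => ->; rewrite ler_piMl// cos_le1.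
Qed.

Lemma normr_sinM x k : `|sin (k%:R * x)| <= k%:R * `|sin x|.
Proof.
elim: k => [|k IHk]; first by rewrite !mul0r sin0 normr0.
rewrite -natr1 !mulrDl !mul1r sinD; apply: (le_trans (ler_normD _ _)).
rewrite !normrM lerD//.
  by apply: le_trans IHk; rewrite ler_piMr// cos_max.
by rewrite ler_piMl// cos_max.
Qed.

(** Strictness appears at [k = 2], since [sin (2 x) = 2 sin x cos x] with [|cos x| < 1], and then
    propagates by induction. *)
Lemma normr_sinM_lt x k : (1 < k)%N -> sin x != 0 ->
  `|sin (k%:R * x)| < k%:R * `|sin x|.
Proof.
move=> + sx; have c1 : `|cos x| < 1.
  rewrite -(@expr_lt1 _ 2)// real_normK ?num_real// cos2sin2.
  by rewrite ltrBlDr ltrDl exprn_even_gt0.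
have s0 : 0 < `|sin x| by rewrite normr_gt0.
case: k => [|[|k]]// _; elim: k => [|k IHk].
  rewrite (_ : 2 * x = x + x); last by ring.
  rewrite sinD; apply: (le_lt_trans (ler_normD _ _)); rewrite !normrM.
  by rewrite [X in _ + X]mulrC -mulr2n -[ltLHS]mulr_natl ltr_pM2l// gtr_pMr.
move: IHk; move: k.+2 => m IHm; rewrite -natr1 !mulrDl !mul1r sinD.
apply: (le_lt_trans (ler_normD _ _)); rewrite !normrM ltr_leD//.
  by apply: le_lt_trans IHm; rewrite ler_piMr// cos_max.
by rewrite ler_piMl// cos_max.
Qed.

Lemma cos_half x : 2 * (1 - cos x) = 4 * sin (x / 2) ^+ 2.
Proof.
rewrite [in LHS](_ : x = (x / 2) *+ 2); last by rewrite mulr2n -splitr.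
by rewrite cos_mulr2n cos2sin2 mulr2n; ring.
Qed.

Lemma chord_factor_le x k :
  2 * (1 - cos (k%:R * x)) <= 4 * sin (x / 2) ^+ 2 * k%:R ^+ 2.
Proof.
rewrite cos_half -[leRHS]mulrA -[_ * x / 2]mulrA ler_pM2l// [leRHS]mulrC.
have : `|sin (k%:R * (x / 2))| ^+ 2 <= (k%:R * `|sin (x / 2)|) ^+ 2.
  by rewrite ler_sqr ?nnegrE ?mulr_ge0// normr_sinM.
by rewrite exprMn !real_normK ?num_real.
Qed.

Lemma chord_factor_lt x k : (1 < k)%N -> sin (x / 2) != 0 ->
  2 * (1 - cos (k%:R * x)) < 4 * sin (x / 2) ^+ 2 * k%:R ^+ 2.
Proof.
move=> k1 sx; rewrite cos_half -[ltRHS]mulrA -[_ * x / 2]mulrA ltr_pM2l// [ltRHS]mulrC.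
have : `|sin (k%:R * (x / 2))| ^+ 2 < (k%:R * `|sin (x / 2)|) ^+ 2.
  by rewrite ltr_sqr ?nnegrE ?mulr_ge0// normr_sinM_lt.
by rewrite exprMn !real_normK ?num_real.
Qed.

(** Recovers [k ^ 2] from small chords, uniformly in [k < N]: for [v = k e / 2], [sin v ^ 2 >= v ^ 2
    cos v ^ 2 = v ^ 2 (1 - sin v ^ 2)] and [sin v <= N e]. *)
Lemma chord_factor_ge (e : R) k N : (k < N)%N -> 0 <= e -> e * N%:R <= 1 ->
  k%:R ^+ 2 * e ^+ 2 * (1 - (N%:R * e) ^+ 2) <= 2 * (1 - cos (k%:R * e)).
Proof.
move=> kN e0 eN; rewrite cos_half.
have p2 := pi_ge2 R.
have ke : k%:R * e <= N%:R * e by rewrite ler_wpM2r// ler_nat ltnW.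
have k0 : 0 <= k%:R * e by rewrite mulr_ge0.
set v := k%:R * e / 2; have v0 : 0 <= v by rewrite divr_ge0.
have h : v * cos v <= sin v by apply: sin_ge_mul_cos; rewrite /v; lra.
have cv : 0 <= cos v by apply: cos_ge0_pihalf; rewrite /v; lra.
have h2 : (v * cos v) ^+ 2 <= sin v ^+ 2.
  by rewrite ler_pXn2r// nnegrE; [rewrite mulr_ge0|apply: le_trans h; rewrite mulr_ge0].
have sv : sin v <= N%:R * e by apply: (le_trans (sin_le v0)); rewrite /v; lra.
have sv0 : 0 <= sin v by apply: le_trans h; rewrite mulr_ge0.
have h3 : sin v ^+ 2 <= (N%:R * e) ^+ 2.
  by rewrite ler_pXn2r// nnegrE (le_trans sv0).
have h4 : v ^+ 2 * (1 - (N%:R * e) ^+ 2) <= sin v ^+ 2.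
  apply: le_trans h2; rewrite [leRHS]exprMn cos2sin2 ler_wpM2l ?sqr_ge0//; lra.
rewrite (_ : _ * _ = 4 * (v ^+ 2 * (1 - (N%:R * e) ^+ 2))).
  by rewrite ler_pM2l.
by rewrite /v; field.
Qed.

(** The form in which limits are taken below. *)
Lemma le_addr_divn (a b C : R) : (forall N, (1 < N)%N -> a <= b + C / N%:R) -> a <= b.
Proof.
move=> h; apply/ler_addgt0Pr => e e0.
pose N := (Num.truncn (`|C| / e)).+2.
apply: (le_trans (h N isT)); rewrite lerD2l.
rewrite ler_pdivrMr// -ler_pdivrMl// mulrC.
apply: le_trans (_ : `|C| / e <= _).
  by rewrite ler_pM2r ?invr_gt0// ler_norm.
apply/ltW/(lt_le_trans (truncnS_gt _)).
by rewrite ler_nat.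
Qed.

End Trig.

(** * Fourier coefficients of chords *)

Section ChordSpectrum.
Context {R : realType}.
Implicit Types (f : R -> R) (s x : R).

Definition chord f s : R -> R := fun t => f (t + s) - f t.

Lemma continuous_chord f s : continuous f -> continuous (chord f s).
Proof. by move=> cf; rewrite /chord; cts. Qed.

Lemma fcos_shift f s k : continuous f -> periodic f (2 * pi) ->
  fcos (fun t => f (t + s)) k =
  cos (k%:R * s) * fcos f k + sin (k%:R * s) * fsin f k.
Proof.
move=> cf pf; pose g t := f t * cos (k%:R * (t - s)).
have cg : continuous g by rewrite /g; cts.
rewrite /fcos /fsin -!meanZ; [|cts..]; rewrite -meanD; [|cts..].
transitivity (mean (fun t => g (t + s))).
  by apply: eq_mean => t; rewrite /g addrK.
rewrite mean_shift//; first by apply: eq_mean => t; rewrite /g mulrBr cosB; ring.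
by move=> t; rewrite /g pf -addrA [2 * pi - s]addrC addrA cosnD2pi.
Qed.

Lemma fsin_shift f s k : continuous f -> periodic f (2 * pi) ->
  fsin (fun t => f (t + s)) k =
  cos (k%:R * s) * fsin f k - sin (k%:R * s) * fcos f k.
Proof.
move=> cf pf; pose g t := f t * sin (k%:R * (t - s)).
have cg : continuous g by rewrite /g; cts.
rewrite /fcos /fsin -!meanZ; [|cts..]; rewrite -meanB; [|cts..].
transitivity (mean (fun t => g (t + s))).
  by apply: eq_mean => t; rewrite /g addrK.
rewrite mean_shift//; first by apply: eq_mean => t; rewrite /g mulrBr sinB; ring.
by move=> t; rewrite /g pf -addrA [2 * pi - s]addrC addrA sinnD2pi.
Qed.

(** Translation by [s] rotates the pair of coefficients by the angle [k s], and [|exp (i k s) - 1| ^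
    2 = 2 (1 - cos (k s))]. *)
Lemma fpow_chord f s k : continuous f -> periodic f (2 * pi) ->
  fpow (chord f s) k = 2 * (1 - cos (k%:R * s)) * fpow f k.
Proof.
move=> cf pf.
have -> : fpow (chord f s) k =
    (fcos (fun t => f (t + s)) k - fcos f k) ^+ 2 +
    (fsin (fun t => f (t + s)) k - fsin f k) ^+ 2.
  rewrite /fpow /fcos /fsin /chord.
  under [X in X ^+ 2 + _]eq_mean do rewrite mulrBl.
  under [X in _ + X ^+ 2]eq_mean do rewrite mulrBl.
  by rewrite !meanB//; cts.
rewrite fcos_shift// fsin_shift// /fpow.
have h := cos2Dsin2 (k%:R * s).
set c := cos _ in h *; set d := sin _ in h *.
have -> : 2 * (1 - c) = c ^+ 2 + d ^+ 2 - 2 * c + 1 by rewrite h; ring.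
ring.
Qed.

Lemma lipschitz_chord L f s : lipschitz L f -> lipschitz (4 * L) (chord f s).
Proof.
move=> lf x y; have := lf (x + s) (y + s); have := lf x y.
rewrite (_ : x + s - (y + s) = x - y); last by ring.
rewrite /chord; set a := f (x + s); set b := f (y + s).
set c := f x; set d := f y => h1 h2.
(* Parallelogram identity: the squared difference of the two increments is at most twice the sum of
   their squares, hence the factor 4. *)
have : 0 <= ((a - b) + (c - d)) ^+ 2 by exact: sqr_ge0.
rewrite !expr2 in h1 h2 *; lra.
Qed.

Lemma periodic_chord f s : periodic f (2 * pi) -> periodic (chord f s) (2 * pi).
Proof. by move=> pf t; rewrite /chord addrAC !pf. Qed.

End ChordSpectrum.

(** * Chords of a Lipschitz closed curve *)

Section CurveSpectrum.
Context {R : realType} {n : nat}.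
Context (F : 'I_n -> R -> R).
Context (cF : forall i, continuous (F i)).
Context (pF : forall i, periodic (F i) (2 * pi)).
Context (lF : forall x y, \sum_(i < n) (F i x - F i y) ^+ 2 <= (x - y) ^+ 2).
Implicit Types (s x : R) (k N : nat).

(** This is [B k] of the overview. [fw R k * P k] differs from [2 B k] only at [k = 0], where the
    factors [1 - cos (k s)] and [k ^ 2] vanish. *)
Let P k : R := \sum_(i < n) fpow (F i) k.
Let Phi s : R := mean (fun t => \sum_(i < n) chord (F i) s t ^+ 2).

Let P_ge0 k : 0 <= P k.
Proof. by apply: sumr_ge0 => i _; exact: fpow_ge0. Qed.

Let cchord i s : continuous (chord (F i) s).
Proof. exact: continuous_chord. Qed.

Let lip1 i : lipschitz 1 (F i).
Proof.
move=> x y; rewrite mul1r; apply: le_trans (lF x y).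
by rewrite (bigD1 i)//= lerDl; apply: sumr_ge0 => j _; exact: sqr_ge0.
Qed.

Let sum_fpow_chord s N :
  \sum_(i < n) \sum_(k < N) fw R k * fpow (chord (F i) s) k =
  \sum_(k < N) 2 * (1 - cos (k%:R * s)) * (fw R k * P k).
Proof.
rewrite exchange_big /=; apply: eq_bigr => k _.
rewrite /P !mulr_sumr; apply: eq_bigr => i _.
by rewrite fpow_chord// mulrCA.
Qed.

Let PhiE s : Phi s = \sum_(i < n) mean (fun t => chord (F i) s t ^+ 2).
Proof.
rewrite /Phi mean_sum// => i.
by have ci : continuous (chord (F i) s) by []; cts.
Qed.

Let bessel_chord s N :
  \sum_(k < N) 2 * (1 - cos (k%:R * s)) * (fw R k * P k) <= Phi s.
Proof. by rewrite -sum_fpow_chord PhiE; apply: ler_sum => i _; exact: bessel. Qed.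

Let parseval_chord s N : (0 < N)%N -> Phi s <=
  \sum_(k < N) 2 * (1 - cos (k%:R * s)) * (fw R k * P k) + 32 * n%:R / N%:R.
Proof.
move=> N0; rewrite -sum_fpow_chord PhiE.
(* Each coordinate has [lipschitz] constant 1, so its chord has constant 4 and [parseval_upper]
   costs [8 * 4 / N]. *)
have -> : 32 * n%:R / N%:R = \sum_(i < n) (8 * (4 * 1) / N%:R) :> R.
  by rewrite sumr_const card_ord -mulr_natl; ring.
rewrite -big_split /=; apply: ler_sum => i _.
by apply: parseval_upper => //; [exact: periodic_chord|exact: lipschitz_chord].
Qed.

Let Phi_le_sqr s : Phi s <= s ^+ 2.
Proof.
rewrite -[leRHS]mean_cst; apply: mean_le => [||t _].
- apply: continuous_bigsum => i; exact: continuous_sqrf (@cchord i s).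
- exact: continuous_cst.
- by apply: le_trans (lF _ _) _; rewrite [t + s]addrC addrK.
Qed.

(* [Phi e <= e ^ 2] bounds the energy as [e] tends to 0; no derivative of the
   curve is involved. *)
Let energy_le1 N : \sum_(k < N) k%:R ^+ 2 * (fw R k * P k) <= 1.
Proof.
set S := \sum_(_ < _) _.
have S0 : 0 <= S.
  by apply: sumr_ge0 => k _; rewrite mulr_ge0 ?sqr_ge0 ?mulr_ge0// ltW// fw_gt0.
have key (e : R) : 0 < e -> e * N%:R <= 1 -> S * (1 - (N%:R * e) ^+ 2) <= 1.
  move=> e0 eN; rewrite -(@ler_pM2l _ (e ^+ 2)) ?exprn_gt0// mulr1.
  apply: le_trans (Phi_le_sqr e); apply: le_trans (bessel_chord e N).
  rewrite mulr_suml mulr_sumr; apply: ler_sum => k _.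
  rewrite [leLHS](_ : _ = k%:R ^+ 2 * e ^+ 2 * (1 - (N%:R * e) ^+ 2) * (fw R k * P k)).
    rewrite ler_wpM2r ?mulr_ge0 ?(ltW (fw_gt0 k))//.
    exact: chord_factor_ge (ltn_ord k) (ltW e0) eN.
  by ring.
apply: (@le_addr_divn _ _ _ S) => m m1.
have m0 : 0 < m%:R :> R by rewrite ltr0n ltnW.
have N0 : 0 < N.+1%:R :> R by [].
(* This [e] makes [N e <= 1 / m], so the loss [S (N e) ^ 2] is at most [S / m]; [N.+1] keeps the
   divisor positive when [N = 0]. *)
have := key (m%:R^-1 / N.+1%:R) ltac:(by rewrite mulr_gt0 ?invr_gt0).
set r := N%:R / N.+1%:R : R.
have r0 : 0 <= r by rewrite divr_ge0.
have r1 : r <= 1 by rewrite ler_pdivrMr// mul1r ler_nat.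
have mV0 : 0 < m%:R^-1 :> R by rewrite invr_gt0.
have mV1 : m%:R^-1 <= 1 :> R by rewrite invf_le1// ler1n ltnW.
have -> : N%:R * (m%:R^-1 / N.+1%:R) = r * m%:R^-1 by rewrite /r; ring.
have -> : m%:R^-1 / N.+1%:R * N%:R = r * m%:R^-1 by rewrite /r; ring.
have rm : r * m%:R^-1 <= m%:R^-1 by rewrite ler_piMl// ltW.
move=> h; have {h} := h ltac:(exact: le_trans rm mV1).
have : (r * m%:R^-1) ^+ 2 <= m%:R^-1.
  rewrite expr2 -[leRHS]mulr1.
  by rewrite ler_pM// ?mulr_ge0 ?(ltW mV0)// (le_trans rm).
move=> /(ler_wpM2l S0) h1 h2; move: h1 h2; rewrite mulrBr mulr1; lra.
Qed.

Lemma mean_sqr_chord_le s :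
  mean (fun t => \sum_(i < n) chord (F i) s t ^+ 2) <= 4 * sin (s / 2) ^+ 2.
Proof.
apply: (@le_addr_divn _ _ _ (32 * n%:R)) => N N1.
apply: (le_trans (parseval_chord s (ltnW N1))); rewrite lerD2r.
have c0 : 0 <= 4 * sin (s / 2) ^+ 2 :> R by rewrite mulr_ge0 ?sqr_ge0.
rewrite -[leRHS]mulr1; apply: le_trans (ler_wpM2l c0 (energy_le1 N)).
rewrite mulr_sumr; apply: ler_sum => k _; rewrite [leRHS]mulrA ler_wpM2r//.
  by rewrite mulr_ge0 ?(ltW (fw_gt0 k)).
exact: chord_factor_le.
Qed.

Lemma mean_sqr_chord_eq s k : sin (s / 2) != 0 ->
  mean (fun t => \sum_(i < n) chord (F i) s t ^+ 2) = 4 * sin (s / 2) ^+ 2 ->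
  (1 < k)%N -> forall i, fpow (F i) k = 0.
Proof.
move=> s0 Phi_eq k1 i.
(* Power at frequency [k] lowers the bound on [Phi s] by [gap * (2 * P k)], which equality leaves no
   room for. *)
pose gap : R := 4 * sin (s / 2) ^+ 2 * k%:R ^+ 2 - 2 * (1 - cos (k%:R * s)).
have gap0 : 0 < gap by rewrite subr_gt0; exact: chord_factor_lt.
have : gap * (2 * P k) <= 0.
  (* The second summand only covers [N <= k], where the truncated sum does not contain frequency
     [k]. *)
  apply: (@le_addr_divn _ _ _ (32 * n%:R + gap * (2 * P k) * k%:R)) => N N1.
  have hC : 0 <= gap * (2 * P k) by rewrite mulr_ge0 ?(ltW gap0)// mulr_ge0.
  rewrite add0r; case: (leqP N k) => [Nk|kN].
    rewrite ler_pdivlMr ?ltr0n ?(ltnW N1)//.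
    apply: (@le_trans _ _ (gap * (2 * P k) * k%:R)).
      by rewrite ler_wpM2l// ler_nat.
    by rewrite lerDr mulr_ge0.
  apply: (@le_trans _ _ (32 * n%:R / N%:R)); last first.
    by rewrite ler_wpM2r ?invr_ge0// lerDl mulr_ge0.
  have h1 := parseval_chord s (ltnW N1); rewrite /Phi Phi_eq in h1.
  have h2 := ler_wpM2l (mulr_ge0 (ler0n R 4) (sqr_ge0 (sin (s / 2)))) (energy_le1 N).
  have h3 : \sum_(j < N) 2 * (1 - cos (j%:R * s)) * (fw R j * P j) +
      gap * (2 * P k) <=
      4 * sin (s / 2) ^+ 2 * \sum_(j < N) j%:R ^+ 2 * (fw R j * P j).
    rewrite [leRHS]mulr_sumr (bigD1 (Ordinal kN))//= [leRHS](bigD1 (Ordinal kN))//=.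
    have fk : fw R k = 2 by rewrite /fw; case: (k) k1.
    rewrite addrAC lerD//.
      rewrite fk (_ : _ + _ = 4 * sin (s / 2) ^+ 2 * (k%:R ^+ 2 * (2 * P k)))//.
      by rewrite /gap; ring.
    apply: ler_sum => j _; rewrite [leRHS]mulrA ler_wpM2r//.
      by rewrite mulr_ge0 ?(ltW (fw_gt0 j)).
    exact: chord_factor_le.
  rewrite mulr1 in h2; lra.
rewrite pmulr_rle0// pmulr_rle0// => Pk.
have {Pk} : P k == 0 by rewrite eq_le Pk P_ge0.
rewrite psumr_eq0 => [/allP/(_ i)|j _]; last exact: fpow_ge0.
by rewrite mem_index_enum => /(_ isT)/eqP.
Qed.

End CurveSpectrum.

(** All Fejér means of [f] now have frequencies 0 and 1 only, and they converge to [f] at every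
    point. *)
Lemma trigonometric_of_fpow0 (R : realType) (f : R -> R) (x : R) :
  continuous f -> periodic f (2 * pi) -> lipschitz 1 f ->
  (forall k, (1 < k)%N -> fpow f k = 0) ->
  f x = fcos f 0 + 2 * fcos f 1 * cos x + 2 * fsin f 1 * sin x.
Proof.
move=> cf pf lf f0.
have c0 k : (1 < k)%N -> fcos f k = 0 /\ fsin f k = 0.
  move=> /f0/eqP; rewrite /fpow paddr_eq0 ?sqr_ge0// !sqrf_eq0.
  by move=> /andP[/eqP-> /eqP->].
set h := fcos f 1 * cos x + fsin f 1 * sin x.
set g := fcos f 0 + 2 * fcos f 1 * cos x + 2 * fsin f 1 * sin x - f x.
have : g ^+ 2 <= 0.
  (* With [m] the inverse of the order, [g ^ 2 <= 2 (g - 2 m h) ^ 2 + 2 (2 m h) ^ 2 <= 16 m + 8 m ^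
     2 h ^ 2]. *)
  apply: (@le_addr_divn _ _ _ (16 + 8 * h ^+ 2)) => -[|[|N]]// _; rewrite add0r.
  have := @fejer_approximation _ 1 f N.+2 x isT cf pf ler01 lf.
  have -> : fejer_mean f N.+2 x - f x = g - 2 / N.+2%:R * h.
    rewrite /fejer_mean /trigpoly 2!big_ord_recl /= big1 => [|k _]; last first.
      by have [-> ->] := c0 (bump 0 (bump 0 k)) isT; rewrite !mulr0 !mul0r addr0.
    rewrite /bump /= /fejer_weight /fw /= fsin0 !mul0r mul1r cos0 /g /h.
    have : N.+2%:R != 0 :> R by rewrite pnatr_eq0.
    by move=> ?; rewrite addn0 [1%:R * x]mul1r; field.
  set m : R := N.+2%:R^-1.
  have m0 : 0 <= m by rewrite invr_ge0.
  have m1 : m <= 1 by rewrite invf_le1// ler1n.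
  have hm : m ^+ 2 * h ^+ 2 <= m * h ^+ 2.
    by rewrite ler_wpM2r ?sqr_ge0// expr2 ler_piMl.
  have : 0 <= (g - 2 * (2 * m * h)) ^+ 2 by exact: sqr_ge0.
  rewrite -/m mulr1; move: m g h hm {m0 m1} => m g h; lra.
rewrite le_eqVlt ltNge sqr_ge0 orbF sqrf_eq0 subr_eq0 => /eqP <-.
by [].
Qed.

(** * Euclidean norm *)

Section Euclidean.
Context {R : realType} {n : nat}.
Implicit Types (u v w : 'rV[R]_n) (k : R).

Lemma dotvC u v : dotv u v = dotv v u.
Proof. by apply: eq_bigr => i _; rewrite mulrC. Qed.

Lemma dotvDl u v w : dotv (u + v) w = dotv u w + dotv v w.
Proof. by rewrite /dotv -big_split; apply: eq_bigr => i _; rewrite mxE mulrDl. Qed.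

Lemma dotvZl k u v : dotv (k *: u) v = k * dotv u v.
Proof. by rewrite /dotv mulr_sumr; apply: eq_bigr => i _; rewrite mxE mulrA. Qed.

Lemma dotvDr u v w : dotv w (u + v) = dotv w u + dotv w v.
Proof. by rewrite dotvC dotvDl !(dotvC w). Qed.

Lemma dotvZr k u v : dotv u (k *: v) = k * dotv u v.
Proof. by rewrite dotvC dotvZl dotvC. Qed.

Lemma dotv_sqr u : dotv u u = \sum_(i < n) u 0 i ^+ 2.
Proof. by []. Qed.

Lemma dotvv_ge0 u : 0 <= dotv u u.
Proof. by rewrite dotv_sqr; apply: sumr_ge0 => i _; exact: sqr_ge0. Qed.

Lemma sqr_enorm u : enorm u ^+ 2 = dotv u u.
Proof. by rewrite sqr_sqrtr// dotvv_ge0. Qed.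

Lemma enorm_ge0 u : 0 <= enorm u.
Proof. exact: sqrtr_ge0. Qed.

Lemma enorm0 : enorm (0 : 'rV[R]_n) = 0.
Proof.
by rewrite /enorm /dotv big1 ?sqrtr0// => i _; rewrite mxE mul0r.
Qed.

Lemma enormZ k u : enorm (k *: u) = `|k| * enorm u.
Proof.
rewrite /enorm dotvZl dotvZr mulrA -expr2 sqrtrM ?sqr_ge0//.
by rewrite sqrtr_sqr.
Qed.

Lemma dotv_le_enorm u v : dotv u v <= enorm u * enorm v.
Proof.
set a := enorm u; set b := enorm v.
have a0 : 0 <= a by exact: enorm_ge0.
have b0 : 0 <= b by exact: enorm_ge0.
(* Half the squared norm of [b u - a v]. *)
have h : 0 <= (a * b) * (a * b - dotv u v).
  have := dotvv_ge0 (b *: u + (- a) *: v).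
  rewrite dotvDl !dotvDr !dotvZl !dotvZr -!sqr_enorm -/a -/b (dotvC v u).
  by rewrite !expr2; lra.
have [ab0|] := eqVneq (a * b) 0; last first.
  by move=> ab; move: h; rewrite pmulr_rge0 ?subr_ge0// lt_neqAle eq_sym ab mulr_ge0.
rewrite ab0 le_eqVlt; apply/orP; left; apply/eqP.
have z w x : enorm w = 0 -> dotv w x = 0.
  move=> w0; have : dotv w w == 0 by rewrite -sqr_enorm w0 expr0n.
  rewrite dotv_sqr psumr_eq0 => [/allP w0i|i _]; last exact: sqr_ge0.
  apply: big1 => i _; have := w0i i; rewrite mem_index_enum => /(_ isT).
  by rewrite sqrf_eq0 => /eqP ->; rewrite mul0r.
by move/eqP: ab0; rewrite mulf_eq0 => /orP[]/eqP/z h0; rewrite ?h0// dotvC h0.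
Qed.

Lemma enormD u v : enorm (u + v) <= enorm u + enorm v.
Proof.
rewrite -ler_sqr ?nnegrE ?addr_ge0 ?enorm_ge0// sqr_enorm.
rewrite dotvDl !dotvDr -!sqr_enorm (dotvC v u).
have := dotv_le_enorm u v; rewrite !expr2; lra.
Qed.

Lemma enorm_sub_le u v w : enorm (u - w) <= enorm (u - v) + enorm (v - w).
Proof. by apply: le_trans (enormD _ _); rewrite addrA subrK. Qed.

Lemma enormC u v : enorm (u - v) = enorm (v - u).
Proof. by rewrite -opprB -scaleN1r enormZ normrN1 mul1r. Qed.

Lemma enorm_continuous : continuous (@enorm R n).
Proof.
have c2 : continuous (fun v : 'rV[R]_n => dotv v v).
  by apply: continuous_bigsum => i u; apply: continuousM; exact: coord_continuous.
by move=> u; apply: continuous_comp; [exact: c2|exact: sqrt_continuous].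
Qed.

End Euclidean.

(** Cousin's lemma as an induction principle: [Q] enters the supremum of the points where it holds
    from the left, and leaves it to the right unless that supremum is [b]. *)
Lemma gauge_induction (R : realType) (a b : R) (Q : R -> Prop) : a <= b -> Q a ->
  (forall s, a <= s <= b -> exists2 d, 0 < d &
     (forall x, a <= x <= s -> s - d < x -> Q x -> Q s) /\
     (forall y, s <= y <= b -> y < s + d -> Q s -> Q y)) -> Q b.
Proof.
move=> ab Qa gauge.
pose S := [set x | a <= x <= b /\ Q x].
have Sa : S a by split => //; rewrite lexx.
have hS : has_sup S.
  by split; [exists a|exists b => x [/andP[]]].
have saS : a <= sup S by apply: (ub_le_sup hS.2).
have sbS : sup S <= b by apply: ge_sup => //; [exists a|move=> x [/andP[]]].
have [d d0 [gl gr]] := gauge (sup S) ltac:(by rewrite saS).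
have [x [/andP[ax xb] Qx] xd] := sup_adherent d0 hS.
have xs : x <= sup S by apply: (ub_le_sup hS.2); rewrite /S /= ax xb.
have Qs : Q (sup S) by apply: (gl x) => //; rewrite ax.
have [bs|sb] := leP b (sup S).
  by have -> : b = sup S by apply/eqP; rewrite eq_le bs.
pose y := Num.min b (sup S + d / 2).
have sy : sup S < y by rewrite lt_min sb ltrDl divr_gt0.
have Sy : S y.
  have yb : y <= b by rewrite ge_min lexx.
  split; first by rewrite yb (le_trans saS (ltW sy)).
  apply: gr => //; first by rewrite yb ltW.
  by rewrite gt_min; apply/orP; right; lra.
by have := ub_le_sup hS.2 Sy; rewrite leNgt sy.
Qed.

(** * Unit speed curves are 1-Lipschitz *)

Section UnitSpeed.
Context {R : realType} {n : nat}.
Implicit Types c : R -> 'rV[R]_n.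

Lemma unit_derivative_increment c (t e : R) : 0 < e ->
  derivable c t 1 -> enorm ('D_1 c t) = 1 ->
  exists2 d, 0 < d & forall y, `|y - t| < d ->
    enorm (c y - c t) <= (1 + e) * `|y - t|.
Proof.
move=> e0 dc nc.
have dq : h^-1 *: ((c \o shift t) (h *: (1 : R)) - c t) @[h --> 0^'] --> 'D_1 c t.
  exact: dc.
(* The quotient converges in the library norm; continuity of [enorm] passes this to Euclidean
   lengths. *)
have := cvg_comp _ _ dq (@enorm_continuous R n ('D_1 c t)); rewrite nc => cn.
have : \forall h \near 0^', enorm (h^-1 *: ((c \o shift t) (h *: (1 : R)) - c t)) < 1 + e.
  by apply: (cvgr_lt 1 cn); rewrite ltrDl.
move=> /nbhs_ballP [d /= d0 hd]; exists d => // y yd.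
have [->|yt] := eqVneq y t.
  by rewrite !subrr normr0 mulr0 enorm0.
have h0 : y - t != 0 by rewrite subr_eq0.
have := hd (y - t).
rewrite /ball /= sub0r normrN => /(_ yd h0).
rewrite enormZ /GRing.scale /= mulr1 subrK normfV => /ltW.
by rewrite ler_pdivrMl ?normr_gt0// mulrC.
Qed.

Lemma null_set_cover (N : set R) (e : R) : 0 < e ->
  (@lebesgue_measure R).-negligible N ->
  exists U : set R, [/\ open U, N `<=` U & (lebesgue_measure U < e%:E)%E].
Proof.
move=> e0 [A [mA A0 NA]].
have muA : (lebesgue_measure A < +oo)%E by rewrite (_ : lebesgue_measure A = 0%E).
have [U [oU AU UA]] := lebesgue_regularity_outer mA muA e0.
exists U; split => //; first exact: subset_trans AU.
have mU : measurable U by exact: open_measurable.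
rewrite -(setDUK AU) measureU//; last 2 first.
- exact: measurableD.
- by rewrite setDIK.
by rewrite [X in (X + _)%R]A0 add0r.
Qed.

(** Supplies the two conditions of [abs_continuous] for ordered intervals inside a small open
    set. *)
Lemma disjoint_intervals_length (U : set R) (m : nat) (l r : nat -> R) (d : R) :
  open U -> (lebesgue_measure U < d%:E)%E ->
  (forall i, (i < m)%N -> l i <= r i /\ `]l i, r i[%classic `<=` U) ->
  (forall i j, (i < j < m)%N -> r i <= l j) ->
  trivIset setT (fun i : 'I_m => `]l i, r i[%classic) /\
  \sum_(i < m) (r i - l i) < d.
Proof.
move=> oU Ud lrU ord.
have tr : trivIset setT (fun i : 'I_m => `]l i, r i[%classic).
  move=> i j _ _ [x [/=]]; rewrite !in_itv /= => /andP[x1 x2] /andP[x3 x4].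
  apply/val_inj/eqP; case: ltngtP => // ij; exfalso.
    by have := ord i j ltac:(by rewrite ij ltn_ord); lra.
  by have := ord j i ltac:(by rewrite ij ltn_ord); lra.
split => //; rewrite -lte_fin; apply: le_lt_trans Ud.
rewrite -sumEFin.
rewrite (_ : (\sum_(i < m) _)%E =
    (\sum_(i < m) lebesgue_measure (`]l i, r i[%classic : set R))%E); last first.
  apply: eq_bigr => i _; rewrite [RHS]lebesgue_measure_itv /= lte_fin.
  have [//|h] := ltP (l i) (r i).
  have [h2 _] := lrU i (ltn_ord i).
  by rewrite (_ : r i = l i) ?subrr//; apply/eqP; rewrite eq_le h.
rewrite -measure_bigsetU_ord//.
apply: le_measure; rewrite ?inE.
- by apply: bigsetU_measurable => i _; exact: measurable_itv.
- exact: open_measurable.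
- by elim/big_ind : _ => [|X Y XU YU|i _]; [exact: sub0set|rewrite subUset|exact: (lrU i (ltn_ord i)).2].
Qed.

(* A partition of [a, b] fine for a gauge: at differentiability points the
   gauge controls increments by [(1 + e)] times the length, while the remaining
   points are covered by an open set too small for the total variation over it
   to exceed [e]. *)
Lemma unit_speed_increment c (T a b : R) :
  abs_continuous 0 T c ->
  {ae @lebesgue_measure R, forall t, derivable c t 1 /\ enorm ('D_1 c t) = 1} ->
  0 <= a -> a <= b -> b <= T -> enorm (c b - c a) <= b - a.
Proof.
move=> ac ae a0 ab bT; apply/ler_addgt0Pr => e0 e0_gt0.
(* Good steps cost [e * (b - a)] and bad intervals cost [e], in total [e0]. *)
pose e := e0 / (b - a + 1).
have ba : 0 < b - a + 1 by lra.
have e_gt0 : 0 < e by rewrite divr_gt0.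
have [d d0 hd] := ac e e_gt0.
have [U [oU badU Ud]] := null_set_cover d0 ae.
(* Only the bad intervals of the partition are recorded; good steps are absorbed in
   [(1 + e) * (x - a)]. The ordering lets a new interval be appended and later gives
   disjointness. *)
pose Q x := exists m (l r : nat -> R),
  [/\ forall i, (i < m)%N -> [/\ a <= l i, l i <= r i, r i <= x & `]l i, r i[%classic `<=` U],
      forall i j, (i < j < m)%N -> r i <= l j
    & enorm (c x - c a) <= (1 + e) * (x - a) + \sum_(i < m) enorm (c (r i) - c (l i))].
have step_good x y : x <= y -> enorm (c y - c x) <= (1 + e) * (y - x) -> Q x -> Q y.
  move=> xy h [m [l [r [lr ord hx]]]]; exists m, l, r; split => //.
    by move=> i /lr[? ? rx ?]; split => //; exact: le_trans xy.
  by have := enorm_sub_le (c y) (c x) (c a); lra.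
have step_bad x y : a <= x -> x <= y -> `]x, y[%classic `<=` U -> Q x -> Q y.
  move=> ax xy xyU [m [l [r [lr ord hx]]]].
  exists m.+1, (fun i => if (i < m)%N then l i else x),
    (fun i => if (i < m)%N then r i else y); split.
  - move=> i; rewrite ltnS leq_eqVlt => /predU1P[->|im]; first by rewrite ltnn.
    by rewrite im; have [? ? rx ?] := lr i im; split => //; exact: le_trans xy.
  - move=> i j /andP[ij]; rewrite ltnS leq_eqVlt => /predU1P[jm|jm].
      by rewrite jm ltnn -jm ij; have [] := lr i ltac:(by rewrite -jm).
    by rewrite jm (ltn_trans ij jm); apply: ord; rewrite ij.
  - rewrite big_ord_recr /= ltnn.
    under eq_bigr do rewrite ltn_ord.
    have e1 : 0 <= (1 + e) * (y - x) by rewrite mulr_ge0; lra.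
    by have := enorm_sub_le (c y) (c x) (c a); lra.
have Qb : Q b.
  apply: (@gauge_induction R a b) => //.
    exists 0%N, (fun=> 0), (fun=> 0); split => //.
    by rewrite big_ord0 !subrr mulr0 addr0 enorm0.
  move=> s /andP[as_ sb].
  have [sU|sU] := pselect (U s).
    have /nbhs_ballP [f /= f0 fU] : nbhs s U by exact: open_nbhs_nbhs.
    exists f => //; split => [x /andP[ax xs] fx|y /andP[sy yb] yf].
      apply: step_bad => // z; rewrite /= in_itv /= => /andP[z1 z2].
      by apply: fU; rewrite /ball /= gtr0_norm; lra.
    apply: step_bad => // z; rewrite /= in_itv /= => /andP[z1 z2].
    by apply: fU; rewrite /ball /= ltr0_norm; lra.
  have [ds ns] : derivable c s 1 /\ enorm ('D_1 c s) = 1.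
    by apply: contrapT => h; apply: sU; exact: badU.
  have [f f0 hf] := unit_derivative_increment e_gt0 ds ns.
  exists f => //; split => [x /andP[ax xs] fx|y /andP[sy yb] yf].
    apply: step_good => //; rewrite enormC.
    have xs0 : `|x - s| = s - x by rewrite distrC ger0_norm// subr_ge0.
    by rewrite -xs0; apply: hf; rewrite xs0; lra.
  apply: step_good => //.
  have ys0 : `|y - s| = y - s by rewrite ger0_norm// subr_ge0.
  by rewrite -ys0; apply: hf; rewrite ys0; lra.
have [m [l [r [lr ord hb]]]] := Qb.
have [tr len] : trivIset setT (fun i : 'I_m => `]l i, r i[%classic) /\
    \sum_(i < m) (r i - l i) < d.
  by apply: disjoint_intervals_length Ud _ ord => // i /lr[].
have := hd m (fun i => l i) (fun i => r i) _ tr len => /(_ _)/ltW h.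
have {}h : \sum_(i < m) enorm (c (r i) - c (l i)) <= e.
  by apply: h => i; have [? ? ? _] := lr i (ltn_ord i); split; lra.
have -> : e0 = e * (b - a + 1) by rewrite /e divfK// lt0r_neq0.
by move: hb h; rewrite !mulrDl !mulrDr; lra.
Qed.

(** Absolute continuity is given on [[0, 2 * pi]] only. Periodicity carries the bound to any single
    period, chaining at multiples of [2 * pi] to nonnegative parameters, and a translation by whole
    periods to all others. *)
Lemma unit_speed_lipschitz c : closed_unit_speed_curve c ->
  forall x y, enorm (c x - c y) <= `|x - y|.
Proof.
move=> [pc ac ae].
have p0 := @twopi_gt0 R.
have pern k x : c (x + k%:R * (2 * pi)) = c x.
  by rewrite mulr_natl; exact: periodicn.
have one_period k x y : k%:R * (2 * pi) <= x -> x <= y -> y <= k.+1%:R * (2 * pi) ->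
    enorm (c y - c x) <= y - x.
  rewrite -natr1 mulrDl mul1r => kx xy yk.
  rewrite -(subrK (k%:R * (2 * pi)) x) -(subrK (k%:R * (2 * pi)) y) !pern.
  apply: le_trans (unit_speed_increment ac ae _ _ _) _; lra.
have periods k x y : 0 <= x -> x <= y -> y <= k%:R * (2 * pi) ->
    enorm (c y - c x) <= y - x.
  elim: k x y => [|k IHk] x y x0 xy yk.
    have -> : y = x by rewrite mul0r in yk; lra.
    by rewrite !subrr enorm0.
  have [yk'|yk'] := leP y (k%:R * (2 * pi)); first exact: IHk.
  have [kx|kx] := leP (k%:R * (2 * pi)) x; first exact: one_period kx xy yk.
  apply: le_trans (enorm_sub_le _ (c (k%:R * (2 * pi))) _) _.
  have h1 := IHk x (k%:R * (2 * pi)) x0 (ltW kx) (lexx _).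
  have h2 := one_period k (k%:R * (2 * pi)) y (lexx _) (ltW yk') yk.
  lra.
have ordered x y : x <= y -> enorm (c y - c x) <= y - x.
  move=> xy.
  have large (z : R) : exists k : nat, z <= k%:R * (2 * pi).
    exists (Num.truncn (`|z| / (2 * pi))).+1.
    rewrite -ler_pdivrMr//; apply/ltW/(le_lt_trans _ (truncnS_gt _)).
    by rewrite ler_pM2r ?invr_gt0// ler_norm.
  have [k kx] := large (- x).
  have [m my] := large (y + k%:R * (2 * pi)).
  rewrite -(pern k y) -(pern k x).
  apply: le_trans (periods m _ _ _ _ my) _; lra.
move=> x y; have [xy|/ltW yx] := leP x y.
  by rewrite enormC distrC ger0_norm ?subr_ge0//; exact: ordered.
by rewrite ger0_norm ?subr_ge0//; exact: ordered.
Qed.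

End UnitSpeed.

(** * Ellipses *)

Section Ellipse.
Context {R : realType} {n : nat}.
Context (p u v : 'rV[R]_n).

Let c (t : R) : 'rV[R]_n := p + cos t *: u + sin t *: v.
Let W (t : R) : 'rV[R]_n := (- sin t) *: u + cos t *: v.

(** Chords centred at [t] are exact multiples of the velocity [W t]; this turns information on
    chords into information on speed. *)
Lemma ellipse_chord t h : c (t + h) - c (t - h) = (2 * sin h) *: W t.
Proof.
by apply/rowP => i; rewrite !mxE cosB sinB !cosD !sinD; ring.
Qed.

Lemma dotv_ellipse_velocity t : dotv (W t) (W t) =
  sin t ^+ 2 * dotv u u + cos t ^+ 2 * dotv v v - 2 * (sin t * cos t * dotv u v).
Proof.
by rewrite /W dotvDl !dotvDr !dotvZl !dotvZr (dotvC v u); ring.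
Qed.

Lemma ellipse_velocity_le1 : (forall x y, enorm (c x - c y) <= `|x - y|) ->
  forall t, dotv (W t) (W t) <= 1.
Proof.
move=> lc t; have w0 := dotvv_ge0 (W t); set w := dotv _ _ in w0 *.
have p2 := pi_ge2 R.
(* For [h = 1 / N], [sin h ^ 2 * w <= h ^ 2] and [sin h ^ 2 >= h ^ 2 (1 - h ^ 2)] give
   [w <= 1 + h ^ 2 w]. *)
apply: (@le_addr_divn _ _ _ w) => N N1.
set h : R := N%:R^-1.
have N0 : 0 < N%:R :> R by rewrite ltr0n ltnW.
have h0 : 0 < h by rewrite invr_gt0.
have h1 : h <= 1 by rewrite invf_le1// ler1n ltnW.
have := lc (t + h) (t - h); rewrite ellipse_chord.
have -> : t + h - (t - h) = 2 * h by ring.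
have s_ge : h * cos h <= sin h by apply: sin_ge_mul_cos; lra.
have c0 : 0 <= cos h by apply: cos_ge0_pihalf; lra.
have s0 : 0 <= sin h by apply: le_trans s_ge; rewrite mulr_ge0// ltW.
have s_le : sin h <= h by apply: sin_le; exact: ltW.
rewrite enormZ !ger0_norm ?mulr_ge0 ?(ltW h0)// => hW.
have {}hW : sin h ^+ 2 * w <= h ^+ 2.
  have : (2 * sin h * enorm (W t)) ^+ 2 <= (2 * h) ^+ 2.
    by rewrite ler_sqr// nnegrE !mulr_ge0 ?enorm_ge0 ?(ltW h0).
  by rewrite !exprMn sqr_enorm -/w; lra.
have s2_ge : h ^+ 2 * (1 - h ^+ 2) <= sin h ^+ 2.
  apply: (@le_trans _ _ ((h * cos h) ^+ 2)).
    rewrite exprMn cos2sin2 ler_wpM2l ?sqr_ge0// lerD2l lerN2.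
    by rewrite ler_sqr ?nnegrE// ltW.
  by rewrite ler_sqr ?nnegrE ?mulr_ge0 ?(ltW h0).
have : h ^+ 2 * ((1 - h ^+ 2) * w) <= h ^+ 2 * 1.
  by rewrite mulrA mulr1; apply: le_trans hW; rewrite ler_wpM2r.
rewrite ler_pM2l ?exprn_gt0// mulrBl mul1r lerBlDr => /le_trans; apply.
by rewrite lerD2l mulrC ler_wpM2l// expr2 ler_piMl// ltW.
Qed.

Let q (t : R) := dotv (W t) (W t).

Lemma continuous_ellipse_velocity : continuous q.
Proof.
rewrite (_ : q = fun t => sin t ^+ 2 * dotv u u + cos t ^+ 2 * dotv v v -
    2 * (sin t * cos t * dotv u v)); first by cts.
by apply/funext => t; exact: dotv_ellipse_velocity.
Qed.

Lemma periodic_ellipse_velocity : periodic q (2 * pi).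
Proof.
move=> t; rewrite /q !dotv_ellipse_velocity.
by have := cosnD2pi 1 t; have := sinnD2pi 1 t; rewrite !mul1r => -> ->.
Qed.

(** A quarter turn exchanges the two squares and flips the cross term, so [q t + q (t + pi / 2)] is
    constant. *)
Lemma mean_ellipse_velocity : mean q = (dotv u u + dotv v v) / 2.
Proof.
have cq : continuous q by exact: continuous_ellipse_velocity.
have h : mean (fun t => q t + q (t + pi / 2)) = dotv u u + dotv v v.
  rewrite -[RHS]mean_cst; apply: eq_mean => t.
  rewrite /q !dotv_ellipse_velocity sinDpihalf cosDpihalf sqrrN sin2cos2; ring.
rewrite meanD// in h; last by cts.
by rewrite mean_shift// in h; [lra|exact: periodic_ellipse_velocity].
Qed.

(** The speed bound at 0 and [pi / 2] gives [|v|, |u| <= 1], and the mean forces equality. Then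
    [q t = 1 - sin (2 t) * dotv u v], and the bound at [pi / 4] and [- pi / 4] gives both signs. *)
Lemma ellipse_orthonormal :
  (forall x y, enorm (c x - c y) <= `|x - y|) -> mean q = 1 ->
  [/\ enorm u = 1, enorm v = 1 & dotv u v = 0].
Proof.
move=> lc q1; have W1 := ellipse_velocity_le1 lc.
have := mean_ellipse_velocity; rewrite q1 => uv2.
have v1 : dotv v v <= 1.
  by have := W1 0; rewrite dotv_ellipse_velocity sin0 cos0; lra.
have u1 : dotv u u <= 1.
  by have := W1 (pi / 2); rewrite dotv_ellipse_velocity sin_pihalf cos_pihalf; lra.
have uE : dotv u u = 1 by lra.
have vE : dotv v v = 1 by lra.
split; [by rewrite /enorm uE sqrtr1|by rewrite /enorm vE sqrtr1|].
have qE t : dotv (W t) (W t) = 1 - sin (2 * t) * dotv u v.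
  have -> : 2 * t = t *+ 2 by rewrite mulr_natl.
  by rewrite dotv_ellipse_velocity uE vE cos2sin2 sin_mulr2n mulr2n; ring.
have := W1 (pi / 4); have := W1 (- (pi / 4)); rewrite !qE.
have -> : 2 * - (pi / 4) = - (pi / 2) :> R by field.
have -> : 2 * (pi / 4) = pi / 2 :> R by field.
by rewrite sinN sin_pihalf; lra.
Qed.

End Ellipse.

(** * The mean chord inequality and its equality case *)

Lemma lipschitz_continuous (R : realType) (f : R -> R) : lipschitz 1 f -> continuous f.
Proof.
move=> lf x; apply/cvgrPdist_lt => e e0.
near=> y; apply: (@le_lt_trans _ _ `|x - y|).
  rewrite -ler_sqr ?nnegrE// !real_normK ?num_real//.
  by have := lf x y; rewrite mul1r.
by near: y; exact: cvgr_dist_lt.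
Unshelve. all: by end_near. Qed.

Unset Implicit Arguments.

Theorem corollary3p2 (R : realType) (n : nat) (hn : (2 <= n)%N)
    (c : R -> 'rV[R]_n) (hc : closed_unit_speed_curve c)
    (s : R) (hs0 : 0 < s) (hs1 : s < 2 * pi) :
  mean_chord c s <= lambda s /\
  (mean_chord c s = lambda s <-> is_unit_circle c).
Proof.
have [pc _ _] := hc.
have lc := unit_speed_lipschitz hc.
pose F (i : 'I_n) (t : R) : R := c t 0 i.
have normE x y : enorm (c x - c y) ^+ 2 = \sum_(i < n) (F i x - F i y) ^+ 2.
  by rewrite sqr_enorm dotv_sqr; apply: eq_bigr => i _; rewrite !mxE.
have lF x y : \sum_(i < n) (F i x - F i y) ^+ 2 <= (x - y) ^+ 2.
  by rewrite -normE -[leRHS]real_normK ?num_real// ler_sqr ?nnegrE ?enorm_ge0.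
have lip i : lipschitz 1 (F i).
  move=> x y; rewrite mul1r; apply: le_trans (lF x y).
  by rewrite (bigD1 i)//= lerDl; apply: sumr_ge0 => j _; exact: sqr_ge0.
have cF i : continuous (F i) by exact: lipschitz_continuous.
have pF i : periodic (F i) (2 * pi) by move=> t; rewrite /F pc.
have s2 : 0 < sin (s / 2) by apply: sin_gt0_pi; lra.
have s2n0 : sin (s / 2) != 0 by rewrite gt_eqF.
have l0 : 0 < lambda s by rewrite mulr_gt0.
have l2 : lambda s ^+ 2 = 4 * sin (s / 2) ^+ 2 by rewrite /lambda exprMn; ring.
pose E t := enorm (c (t + s) - c t).
have E2 t : E t ^+ 2 = \sum_(i < n) chord (F i) s t ^+ 2 by exact: normE.
have cE2 : continuous (fun t => \sum_(i < n) chord (F i) s t ^+ 2).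
  by apply: continuous_bigsum => i; exact: continuous_sqrf (@continuous_chord _ _ s (cF i)).
have cE : continuous E.
  rewrite (_ : E = fun t => Num.sqrt (\sum_(i < n) chord (F i) s t ^+ 2)).
    by move=> t; apply: continuous_comp; [exact: cE2|exact: sqrt_continuous].
  by apply/funext => t; rewrite -E2 sqrtr_sqr ger0_norm// enorm_ge0.
have mE : mean_chord c s = mean E by [].
have mE0 : 0 <= mean E by apply: mean_ge0 => // t; exact: enorm_ge0.
have mE2 : mean E ^+ 2 <= mean (fun t => \sum_(i < n) chord (F i) s t ^+ 2).
  have c1 : continuous (fun _ : R => 1 : R) by exact: continuous_cst.
  have := jensen_sqr c1 cE (fun=> ler01) (mean_cst 1).
  under eq_mean do rewrite mul1r.
  by under [X in _ <= X -> _]eq_mean do rewrite mul1r E2.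
have Phi_le := mean_sqr_chord_le cF pF lF s.
rewrite mE; split.
  by rewrite -ler_sqr ?nnegrE ?(ltW l0)// l2; exact: le_trans Phi_le.
split=> [Eeq|[p [u [v [u1 v1 uv0 cE']]]]]; last first.
  transitivity (mean (fun _ : R => lambda s)); last exact: mean_cst.
  apply: eq_mean => t; rewrite /E.
  (* Centre the chord at [t + s / 2], so that [ellipse_chord] applies with [h = s / 2]. *)
  have -> : t + s = (t + s / 2) + s / 2 by field.
  have {2}-> : t = (t + s / 2) - s / 2 by ring.
  rewrite !cE' ellipse_chord enormZ gtr0_norm//.
  have : dotv u u = 1 by rewrite -sqr_enorm u1 expr1n.
  have : dotv v v = 1 by rewrite -sqr_enorm v1 expr1n.
  rewrite /enorm dotv_ellipse_velocity uv0 => -> ->.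
  by rewrite mulr0 mulr0 subr0 !mulr1 addrC cos2Dsin2 sqrtr1 mulr1.
(* The mean square chord is squeezed between the squared mean chord and [lambda s ^ 2]. *)
have Phi_eq : mean (fun t => \sum_(i < n) chord (F i) s t ^+ 2) = 4 * sin (s / 2) ^+ 2.
  by apply/eqP; rewrite eq_le Phi_le -l2 -Eeq.
pose p : 'rV[R]_n := \row_i fcos (F i) 0.
pose u : 'rV[R]_n := \row_i (2 * fcos (F i) 1).
pose v : 'rV[R]_n := \row_i (2 * fsin (F i) 1).
have cE' t : c t = p + cos t *: u + sin t *: v.
  apply/rowP => i; rewrite !mxE -/(F i t) (trigonometric_of_fpow0 _ (cF i))//.
    by ring.
  move=> k k1; exact: (mean_sqr_chord_eq cF pF lF s2n0 Phi_eq k1 i).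
pose q t := dotv (- sin t *: u + cos t *: v) (- sin t *: u + cos t *: v).
(* The centred chord is [2 sin (s / 2)] times the velocity, so the mean square chord is
   [4 sin (s / 2) ^ 2 * mean q]; compare with [Phi_eq]. *)
have q1 : mean q = 1.
  have cq : continuous q by exact: continuous_ellipse_velocity.
  apply: (mulfI (_ : 4 * sin (s / 2) ^+ 2 != 0)).
    by rewrite mulf_neq0// expf_neq0.
  rewrite mulr1 -[RHS]Phi_eq -(@mean_shift R q (s / 2))//; last first.
    exact: periodic_ellipse_velocity.
  rewrite -meanZ; last by cts.
  apply: eq_mean => t; rewrite -E2 /E.
  have -> : t + s = (t + s / 2) + s / 2 by field.
  have {3}-> : t = (t + s / 2) - s / 2 by ring.
  by rewrite !cE' ellipse_chord sqr_enorm dotvZl dotvZr /q; ring.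
have [u1 v1 uv0] : [/\ enorm u = 1, enorm v = 1 & dotv u v = 0].
  by apply: (ellipse_orthonormal (p := p)) => // x y; rewrite -!cE'.
by exists p, u, v.
Qed.
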